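(* For every integer $n\geq 0$, \[ \overline{p}(5n)\equiv (-1)^{n}\,\overline{p}(20n) \pmod{5}. \]
   Context: An overpartition of a nonnegative integer $n$ is a partition of $n$ (a nonincreasing sequence of positive integers summing to $n$) in which the first occurrence of each distinct part may be overlined. $\overline{p}(n)$ denotes the number of overpartitions of $n$, with $\overline{p}(0)=1$ and $\overline{p}(n)=0$ for $n<0$. Equivalently, $\sum_{n\ge0}\overline{p}(n)q^n=\prod_{k\ge1}\frac{1+q^k}{1-q^k}$. *)

(* Defs.v *)
From mathcomp Require Import all_boot.
Set Implicit Arguments. Unset Strict Implicit. Unset Printing Implicit Defensive.

(* An overpartition is represented as a sequence of (part, overlined?) pairs,
   listed in nonincreasing order of parts. *)

Fixpoint cand_seqs (m k : nat) : seq (seq (nat * bool)) :=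
  match k with
  | 0 => [:: [::]]
  | k'.+1 => [seq x :: s | x <- [seq (i.+1, b) | i <- iota 0 m, b <- [:: false; true]],
                           s <- cand_seqs m k']
  end.

Definition candidates (n : nat) : seq (seq (nat * bool)) :=
  flatten [seq cand_seqs n k | k <- iota 0 n.+1].

Fixpoint first_occ_ok (prev : seq nat) (s : seq (nat * bool)) : bool :=
  match s with
  | [::] => true
  | (a, b) :: s' => (b ==> (a \notin prev)) && first_occ_ok (a :: prev) s'
  end.

Definition is_overpartition (n : nat) (s : seq (nat * bool)) : bool :=
  [&& all (fun x => 0 < x.1) s,
      sorted geq (unzip1 s),
      sumn (unzip1 s) == n &
      first_occ_ok [::] s].

(* number of overpartitions of n; pbar 0 = 1 (the empty overpartition).
   The candidate list is duplicate-free: sequences of different lengths are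
   distinct, and cand_seqs enumerates each length without repetition. *)
Definition pbar (n : nat) : nat := count (is_overpartition n) (candidates n).

(* Main.v *)
(* Let theta(q) = sum_(z in Z) (- q)^(z^2).  Gauss's identity says that theta is
   the inverse of the generating function P of overpartitions.  Modulo 5 this
   gives P(q) theta(q^5) = theta(q)^4, whose coefficient of q^n is
   (-1)^n r_4(n), r_d counting representations as a sum of d squares.  Since
   r_4(5n) = r_4(n) mod 5, the sum of pbar(5n) q^n is theta^4 / theta = theta^3,
   that is pbar(5n) = (-1)^n r_3(n) mod 5, and r_3(4n) = r_3(n) because a sum of
   three squares divisible by 4 has only even terms.
   For r_4: each quaternion x with 5 | N(x) is left divisible by exactly one of
   the six 1 +- 2i, 1 +- 2j, 1 +- 2k of norm 5, or by all six; counting the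
   pairs of such a divisor and x with N(x) = 5n gives r_4(5n) = 6 r_4(n) mod 5. *)
Require Import Defs.
From mathcomp Require Import all_boot all_algebra.
From mathcomp Require Import ring zify.
Import GRing.Theory.
Local Open Scope ring_scope.

(** * Counting overpartitions by their largest part *)

(* The overpartitions of [n] with parts at most [m], the part [m] being barred
   from an overline when [used], that is when [m] has occurred before; [k] is
   fuel, sufficient as soon as [m + n <= k]. *)
Fixpoint ops (k m : nat) (used : bool) (n : nat) : seq (seq (nat * bool)) :=
  if m is m'.+1 then
    if k is k'.+1 then
      ops k' m' false n ++
      (if m <= n then
         [seq (m, b) :: s | b <- if used then [:: false] else [:: false; true],
                            s <- ops k' m true (n - m)]
       else [::])%N
    else [::]
  else if n is 0%N then [:: [::]] else [::].

(** Since every part is at most [m], no larger part can recur, so [used] is all that must be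
    remembered of the earlier parts. *)
Definition valid (m : nat) (used : bool) (n : nat) (s : seq (nat * bool)) :=
  [&& all (fun x => 0 < x.1)%N s, path geq m (unzip1 s), sumn (unzip1 s) == n &
      first_occ_ok (if used then [:: m] else [::]) s].

Lemma first_occ_ok_eq (prev prev' : seq nat) (s : seq (nat * bool)) :
  {in unzip1 s, prev =i prev'} -> first_occ_ok prev s = first_occ_ok prev' s.
Proof.
elim: s prev prev' => [//|[a b] s IH] prev prev' /= H.
rewrite H ?mem_head //; congr (_ && _); apply: IH => x xs.
by rewrite !in_cons H // in_cons xs orbT.
Qed.

Lemma path_geq_le (m : nat) (s : seq nat) (x : nat) :
  path geq m s -> x \in s -> (x <= m)%N.
Proof.
rewrite path_sortedE; last by move=> a b c /= /[swap]; apply: leq_trans.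
by case/andP=> /allP H _ /H.
Qed.

(** Either [m.+1] is absent, and then its earlier occurrence is irrelevant, or it is the first part,
    and then it counts as used in the tail. *)
Lemma validS (m : nat) (used : bool) (n : nat) (s : seq (nat * bool)) :
  valid m.+1 used n s =
  valid m false n s ||
  (if s is (a, b) :: s' then
     [&& a == m.+1, b ==> ~~ used, (m < n)%N & valid m.+1 true (n - m.+1) s']
   else false).
Proof.
rewrite /valid; case: s => [|[a b] s] /=; first by case: used; rewrite orbF.
case: (ltngtP a m.+1) => [lam|lma|->] /=.
- have -> : (a <= m)%N by lia.
  rewrite orbF implybT.
  case: (0 < a)%N => //=; case: all => //=.
  case Hp: (path geq a (unzip1 s)) => //=; case: (_ == n) => //=.
  case: used; last by rewrite implybT.
  rewrite mem_seq1 (_ : (a == m.+1) = false) ?implybT /=; last by apply/eqP; lia.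
  apply: first_occ_ok_eq => x xs; rewrite !in_cons.
  have := path_geq_le _ _ _ Hp xs.
  by case: (x =P m.+1) => // ->; lia.
- by rewrite (_ : (a <= m)%N = false) ?andbF //; lia.
rewrite ltnn /= !andbF /=.
have -> : (first_occ_ok (m.+1 :: (if used then [:: m.+1] else [::])) s)
        = first_occ_ok [:: m.+1] s.
  by apply: first_occ_ok_eq => x _; case: used; rewrite // !in_cons orbA orbb.
have -> : (m.+1 \notin (if used then [:: m.+1] else [::])) = ~~ used.
  by case: used; rewrite // mem_head.
have -> : (m.+1 + sumn (unzip1 s) == n)%N =
          (m < n)%N && (sumn (unzip1 s) == n - m.+1)%N.
  by apply/idP/idP; lia.
by case: (b ==> _); case: (m < n)%N => //=; rewrite ?andbF.
Qed.

Lemma ops_fuel (k k' m : nat) (used : bool) (n : nat) :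
  (m + n <= k)%N -> (m + n <= k')%N -> ops k m used n = ops k' m used n.
Proof.
elim: k k' m used n => [|k IH] [|k'] [|m] used n //= H H'; try lia.
rewrite (IH k') //; try lia.
by case: leqP => // le_mn; rewrite (IH k') //; lia.
Qed.

Lemma mem_ops (k m : nat) (used : bool) (n : nat) (s : seq (nat * bool)) :
  (m + n <= k)%N -> (s \in ops k m used n) = valid m used n s.
Proof.
have valid0 u j t : valid 0 u j t = (t == [::]) && (j == 0)%N.
  case: t => [|[[|a] b] t]; rewrite /valid ?andbF //=.
  by case: u; rewrite /= andbT eq_sym.
elim: k m used n s => [|k IH] [|m] used n s H; try by lia.
- have -> : n = 0%N by lia.
  by rewrite valid0 andbT mem_seq1.
- by rewrite valid0; case: n {H} => [|n] /=; rewrite ?andbF // andbT mem_seq1.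
rewrite [ops _ _ _ _]/= mem_cat IH ?validS; last by lia.
congr (_ || _); case: leqP => lt_mn.
  by case: s => [//|[a b] s] /=; rewrite !andbF.
apply/allpairsP/idP => [[[b t] [/= Hb]]|].
  rewrite IH; last by lia.
  by move=> Ht ->; rewrite eqxx /= Ht; case: used Hb; case: b.
case: s => [//|[a b] s] /and4P [/eqP -> Hb _ Hs].
exists (b, s); split => //=; last by rewrite IH //; lia.
by move: Hb; case: used; case: b.
Qed.

Lemma uniq_ops (k m : nat) (used : bool) (n : nat) :
  (m + n <= k)%N -> uniq (ops k m used n).
Proof.
elim: k m used n => [|k IH] [|m] used n H; try by [case: n {H}|lia].
rewrite [ops _ _ _ _]/= cat_uniq IH ?andTb; last by lia.
case: leqP => // le_mn; apply/andP; split.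
  apply/hasPn => x /allpairsP[[b t] [_ _ ->]].
  rewrite mem_ops; last by lia.
  by rewrite /valid /= ltnn !andbF.
apply: allpairs_uniq; first by case: used.
  by apply: IH; lia.
by move=> [b t] [b' t'] _ _ /= [-> ->].
Qed.

Lemma mem_cand_seqs (m k : nat) (s : seq (nat * bool)) :
  (s \in cand_seqs m k) = (size s == k) && all (fun x => 0 < x.1 <= m)%N s.
Proof.
elim: k s => [|k IH] s; first by case: s => [|x s]; rewrite mem_seq1.
apply/allpairsP/idP => [[[x t] [/allpairsPdep[i [b [Hi _]]]]]|].
  move=> /= ->; rewrite IH => /andP[/eqP <- Ht] -> /=; rewrite eqxx Ht; move: Hi; rewrite mem_iota; lia.
case: s => [//|[a b] s]; rewrite [size _]/= [all _ _]/= => /and3P[Hsz Ha Hs].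
exists ((a, b), s); split => //; last by rewrite IH -eqSS Hsz.
apply/allpairsPdep; exists a.-1, b; split; rewrite ?mem_iota.
- by lia.
- by case: (b).
- by congr (_, _); lia.
Qed.

Lemma uniq_cand_seqs (m k : nat) : uniq (cand_seqs m k).
Proof.
elim: k => [//|k IH]; apply: allpairs_uniq => //; last first.
  by move=> [x t] [y t'] _ _ [-> ->].
apply: allpairs_uniq => //; first exact: iota_uniq.
by move=> [x t] [y t'] _ _ [-> ->].
Qed.

Lemma mem_candidates (n : nat) (s : seq (nat * bool)) :
  (s \in candidates n) = (size s <= n)%N && all (fun x => 0 < x.1 <= n)%N s.
Proof.
apply/flatten_mapP/andP => [[k]|[Hs Ha]].
  by rewrite mem_iota mem_cand_seqs => Hk /andP[/eqP Es]; split=> //; lia.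
by exists (size s); rewrite ?mem_iota ?mem_cand_seqs ?eqxx //; lia.
Qed.

Lemma uniq_candidates (n : nat) : uniq (candidates n).
Proof.
rewrite /candidates; elim: n.+1 0%N => [//|k IH] j /=.
rewrite cat_uniq uniq_cand_seqs IH andbT /=.
apply/hasPn => s /flatten_mapP[i]; rewrite mem_iota !mem_cand_seqs.
by move=> Hi /andP[/eqP -> _]; rewrite negb_and; apply/orP; left; lia.
Qed.

Definition bounded_pbar (m n : nat) : nat := size (ops (m + n) m false n).

Lemma pbar_bounded (m n : nat) : (n <= m)%N -> pbar n = bounded_pbar m n.
Proof.
move=> le_nm; rewrite /pbar -size_filter.
apply/perm_size/uniq_perm; rewrite ?filter_uniq ?uniq_candidates ?uniq_ops //.
move=> s; rewrite mem_filter mem_candidates mem_ops // /is_overpartition /valid /=.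
(* Parts are positive, so the sum bounds both the length and every part, and [candidates n] misses
   no overpartition. *)
have bound (t : seq (nat * bool)) : all (fun x => 0 < x.1)%N t ->
    (size t <= sumn (unzip1 t))%N /\ all (fun x => x.1 <= sumn (unzip1 t))%N t.
  elim: t => [//|[a b] t IH] /= /andP[Ha /IH [Hs /allP Hall]]; split; first by lia.
  by apply/andP; split; [lia|apply/allP => x /Hall /=; lia].
case H0: (all _ s) => //=; case: (bound s H0) => [Hs /allP Hall].
have path_sorted_bound (t : seq nat) : all (fun y => y <= m)%N t -> path geq m t = sorted geq t.
  by case: t => //= y t /andP[-> _].
case: eqP => [Hn|_]; last by rewrite !andbF.
rewrite path_sorted_bound; last first.
  by apply/allP => y /mapP[x /Hall /= Hx ->]; lia.
rewrite -Hn Hs /=.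
have -> : all (fun x => 0 < x.1 <= sumn (unzip1 s))%N s.
  by apply/allP => x xs; rewrite Hall // (allP H0 x xs).
by rewrite !andbT.
Qed.

Lemma bounded_pbar0 (n : nat) : bounded_pbar 0 n = (n == 0)%N.
Proof. by case: n. Qed.

(* With [u] the count in which the part [m.+1] has already occurred, one has
   [u n = bounded_pbar m n + u (n - m.+1)] and
   [bounded_pbar m.+1 n = bounded_pbar m n + 2 * u (n - m.+1)]. *)
Lemma bounded_pbarS (m n : nat) :
  (bounded_pbar m.+1 n =
   bounded_pbar m n +
   (if m < n then bounded_pbar m.+1 (n - m.+1) + bounded_pbar m (n - m.+1) else 0))%N.
Proof.
pose u j := size (ops (m.+1 + j) m.+1 true j).
have gE j : (bounded_pbar m.+1 j =
             bounded_pbar m j + if m < j then (u (j - m.+1)).*2 else 0)%N.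
  rewrite /bounded_pbar /= size_cat; congr (_ + _)%N.
  case: leqP => // lt_mj; rewrite !size_cat !size_map addn0 addnn.
  by rewrite /u (ops_fuel _ (m.+1 + (j - m.+1))) //; lia.
have uE j : (u j = bounded_pbar m j + if m < j then u (j - m.+1) else 0)%N.
  rewrite /bounded_pbar {1}/u /= size_cat; congr (_ + _)%N.
  case: leqP => // lt_mj; rewrite !size_cat !size_map addn0.
  by rewrite /u (ops_fuel _ (m.+1 + (j - m.+1))) //; lia.
(* For [j = n - m.+1], the two relations eliminate [u]: [2 * u j = bounded_pbar m.+1 j +
   bounded_pbar m j]. *)
rewrite gE; case: ltnP => // lt_mn.
by rewrite gE uE; case: ifP => _; lia.
Qed.

(** * Gauss's identity *)

(** Congruence modulo ['X^n], which lets polynomials stand for power series. *)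
Definition eq_trunc {R : nzRingType} (n : nat) (p q : {poly R}) : Prop :=
  forall i, (i < n)%N -> p`_i = q`_i.

Lemma eq_trunc_mul {R : nzRingType} (n : nat) (p p' q q' : {poly R}) :
  eq_trunc n p p' -> eq_trunc n q q' -> eq_trunc n (p * q) (p' * q').
Proof.
move=> Hp Hq i lt_in; rewrite !coefM; apply: eq_bigr => j _.
by rewrite Hp ?Hq //; have := ltn_ord j; lia.
Qed.

(** A factor with constant term 1 is invertible as a power series; the coefficients are recovered
    one after the other. *)
Lemma eq_trunc_mulI {R : nzRingType} (n : nat) (d p q : {poly R}) :
  d`_0 = 1 -> eq_trunc n (d * p) (d * q) -> eq_trunc n p q.
Proof.
move=> d0 H i; elim/ltn_ind: i => i IH lt_in.
have := H i lt_in; rewrite !coefM !big_ord_recl /= d0 !mul1r subn0.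
rewrite (eq_bigr (fun j : 'I_i => d`_(bump 0 j) * q`_(i - bump 0 j))); first exact: addIr.
by move=> j _; rewrite IH //; have := ltn_ord j; rewrite /bump; lia.
Qed.

(** For [m <= n] this is the quotient (q; q)_n / (q; q)_m, written without division. *)
Definition prod_sub {R : comNzRingType} (q : R) (m n : nat) : R :=
  \prod_(m <= i < n) (1 - q ^+ i.+1).

Definition prod_add {R : comNzRingType} (q : R) (m : nat) : R :=
  \prod_(0 <= i < m) (1 + q ^+ i.+1).

Definition box (N : nat) : seq int :=
  [seq Posz i | i <- iota 0 N.+1] ++ [seq Negz i | i <- iota 0 N].

Definition theta {R : comNzRingType} (q : R) (N : nat) : R :=
  \sum_(z <- box N) (- q) ^+ (`|z| ^ 2).

Lemma thetaS {R : comNzRingType} (q : R) (N : nat) :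
  theta q N.+1 = theta q N + (- q) ^+ (N.+1 ^ 2) *+ 2.
Proof.
have iotaS k : iota 0 k.+1 = iota 0 k ++ [:: k] by rewrite -addn1 iotaD.
rewrite /theta /box (iotaS N.+1) (iotaS N) !map_cat !big_cat /= !big_seq1 !absz_nat.
by rewrite mulr2n; ring.
Qed.

Lemma theta0 {R : comNzRingType} (q : R) : theta q 0 = 1.
Proof. by rewrite /theta /box big_cat /= big_nil big_seq1 addr0. Qed.

(* [\prod_(i < s) (1 + q ^+ i)], the factor for [i = 0] being [2]. *)
Definition prod_add0 {R : comNzRingType} (q : R) (s : nat) : R :=
  \prod_(0 <= i < s) (1 + q ^+ i).

(* A truncation of the q-binomial series
   [\sum_s (-1; q)_s / (q; q)_s z^s] at [z = - q ^+ n.+1], times [(q; q)_n]. *)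
Definition binomial_sum {R : comNzRingType} (q : R) (n : nat) : R :=
  \sum_(0 <= s < n.+1) prod_sub q s n * prod_add0 q s * (- q ^+ n.+1) ^+ s.

(** The q-binomial series F(z) = (-z; q)_oo / (z; q)_oo satisfies (1 - z) F(z) = (1 + z) F(q z); the
    last term is the error caused by truncation. *)
Lemma binomial_sum_step {R : comNzRingType} (q z : R) (n k : nat) : (k <= n)%N ->
  (1 - z) * (\sum_(0 <= s < k.+1) prod_sub q s n * prod_add0 q s * z ^+ s) =
  (1 + z) * (\sum_(0 <= s < k.+1) prod_sub q s n * prod_add0 q s * (q * z) ^+ s)
  - prod_sub q k n * prod_add0 q k.+1 * z ^+ k.+1.
Proof.
have addE s : prod_add0 q s.+1 = prod_add0 q s * (1 + q ^+ s).
  by rewrite /prod_add0 big_nat_recr.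
elim: k => [|k IH] le_kn.
  by rewrite !big_nat1 !expr0 expr1 addE expr0 /prod_add0 big_geq //; ring.
rewrite big_nat_recr //= mulrDr IH; last by lia.
rewrite [in RHS]big_nat_recr //= [in RHS]mulrDr (addE k.+1).
have -> : prod_sub q k n = (1 - q ^+ k.+1) * prod_sub q k.+1 n.
  by rewrite /prod_sub big_ltn.
move: (prod_sub _ _ _) (prod_add0 _ _) (\sum_(_ <= _ < _) _) => a b c.
by rewrite (exprMn _ q z) !(exprS z); ring.
Qed.

(** In [binomial_sum_step] at z = - q^(n+1), the factor 1 + z = 1 - q^(n+1) turns (q; q)_n into (q;
    q)_(n+1), and q z is the next evaluation point. The truncation error and the new term [s = n.+1]
    add up to the last summand. *)
Lemma binomial_sumS {R : comNzRingType} (q : R) (n : nat) :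
  binomial_sum q n.+1 =
  (1 + q ^+ n.+1) * binomial_sum q n + prod_add0 q n.+2 * (- q) ^+ (n.+1 ^ 2).
Proof.
have step := binomial_sum_step q (- q ^+ n.+1) n n (leqnn n).
move: step; rewrite opprK /binomial_sum => ->.
have prodnn k : prod_sub q k k = 1 by rewrite /prod_sub big_geq.
rewrite big_nat_recr //= prodnn mul1r.
rewrite (eq_big_nat _ _ (F2 := fun s => (1 - q ^+ n.+1) *
    (prod_sub q s n * prod_add0 q s * (q * - q ^+ n.+1) ^+ s))); last first.
  move=> s /andP[_ lt_sn]; rewrite /prod_sub big_nat_recr //= mulrN -exprS; ring.
rewrite -mulr_sumr prodnn mul1r.
have -> : prod_add0 q n.+2 = prod_add0 q n.+1 * (1 + q ^+ n.+1).
  by rewrite /prod_add0 big_nat_recr.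
(* The signs agree because a number and its square have the same parity. *)
have signE : (- q) ^+ (n.+1 ^ 2) = (- q ^+ n.+1) ^+ n.+1.
  rewrite -[in RHS]mulN1r exprMn -exprM -mulnn [LHS]exprNn.
  by rewrite -signr_odd oddM andbb signr_odd.
rewrite signE.
have -> : (- q ^+ n.+2) ^+ n.+1 = q ^+ n.+1 * (- q ^+ n.+1) ^+ n.+1.
  by rewrite -exprMn mulrN -exprS.
ring.
Qed.

(* A finite form of Gauss's identity. *)
Lemma prod_add_theta {R : comNzRingType} (q : R) (n : nat) :
  prod_add q n * theta q n = binomial_sum q n.
Proof.
elim: n => [|n IH].
  by rewrite theta0 /binomial_sum big_nat1 /prod_add /prod_sub /prod_add0 !big_geq // expr0 !mulr1.
rewrite binomial_sumS -IH thetaS.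
(* The factor 2 at [i = 0] accounts for the two new terms of [theta], at z = n+1 and z = -(n+1). *)
have -> : prod_add0 q n.+2 = prod_add q n.+1 *+ 2.
  by rewrite /prod_add0 big_nat_recl // expr0 -mulr2n mulr_natl.
have -> : prod_add q n.+1 = prod_add q n * (1 + q ^+ n.+1).
  by rewrite /prod_add big_nat_recr.
move: ((- q) ^+ _) (q ^+ n.+1) => a b.
ring.
Qed.

(** In [binomial_sum], the term of index [s] is divisible by X^((n+1) s), so only [s = 0]
    survives. *)
Lemma prod_add_theta_trunc {R : comNzRingType} (n : nat) :
  eq_trunc n.+1 (prod_add 'X n * theta 'X n) (prod_sub 'X 0 n : {poly R}).
Proof.
move=> i lt_in; rewrite prod_add_theta /binomial_sum big_ltn // expr0.
rewrite {1}/prod_add0 big_geq // !mulr1 coefD [X in _ + X = _](_ : _ = 0) ?addr0 //.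
rewrite big_nat coef_sum big1 // => s /andP[s_gt0 _].
rewrite -mulN1r exprMn -exprM mulrA coefMXn.
by rewrite (_ : (i < _)%N) //; nia.
Qed.

Definition pbar_poly (R : nzRingType) (m N : nat) : {poly R} :=
  \poly_(i < N) (bounded_pbar m i)%:R.

(** This is [bounded_pbarS] in terms of generating functions. *)
Lemma pbar_polyS (R : comNzRingType) (m N : nat) :
  eq_trunc N ((1 - 'X^(m.+1)) * pbar_poly R m.+1 N) ((1 + 'X^(m.+1)) * pbar_poly R m N).
Proof.
move=> i lt_iN; rewrite mulrBl mulrDl !mul1r coefB coefD !coefXnM !coef_poly lt_iN.
rewrite bounded_pbarS; case: ltnP => [lt_mi|le_im]; last first.
  by rewrite ltnS le_im addn0 subr0 addr0.
rewrite ltnS leqNgt lt_mi /= (_ : (i - m.+1 < N)%N) ?(leq_trans _ lt_mi) //; last by lia.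
by rewrite !natrD; ring.
Qed.

Lemma prod_sub_pbar (R : comNzRingType) (m N : nat) :
  eq_trunc N (prod_sub 'X 0 m * pbar_poly R m N) (prod_add 'X m).
Proof.
elim: m => [|m IH].
  rewrite /prod_sub /prod_add !big_geq // mul1r => i lt_iN.
  by rewrite coef_poly lt_iN bounded_pbar0 coef1.
have -> : prod_sub 'X 0 m.+1 = prod_sub 'X 0 m * (1 - 'X^(m.+1)) :> {poly R}.
  by rewrite /prod_sub big_nat_recr.
have -> : prod_add 'X m.+1 = prod_add 'X m * (1 + 'X^(m.+1)) :> {poly R}.
  by rewrite /prod_add big_nat_recr.
move=> i lt_iN; rewrite -mulrA (eq_trunc_mul N _ _ _ _ (fun _ _ => erefl) (pbar_polyS _ _ _)) //.
by rewrite mulrCA mulrC (eq_trunc_mul N _ _ _ _ IH (fun _ _ => erefl)).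
Qed.

Lemma pbar_theta (R : comNzRingType) (N : nat) :
  eq_trunc N.+1 (\poly_(i < N.+1) (pbar i)%:R * theta 'X N) (1 : {poly R}).
Proof.
have -> : \poly_(i < N.+1) (pbar i)%:R = pbar_poly R N N.+1.
  by apply/polyP => i; rewrite !coef_poly; case: ltnP => // ?; rewrite (pbar_bounded N).
(* After multiplication by (q; q)_N, the left side becomes [prod_add 'X N * theta 'X N], to which
   Gauss's identity applies. *)
apply: (eq_trunc_mulI _ (prod_sub 'X 0 N)).
  rewrite /prod_sub -horner_coef0 horner_prod big1 // => i _.
  by rewrite !hornerE expr0n subr0.
move=> i lt_iN; rewrite mulr1 mulrA.
rewrite (eq_trunc_mul N.+1 _ _ _ _ (prod_sub_pbar _ _ _) (fun _ _ => erefl)) //.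
exact: prod_add_theta_trunc.
Qed.

(** * Sums of squares *)

Lemma mem_box (N : nat) (z : int) : (z \in box N) = (`|z| <= N)%N.
Proof.
rewrite mem_cat; apply/orP/idP => [[]/mapP[i]|].
- by rewrite mem_iota => Hi ->; lia.
- by rewrite mem_iota => Hi ->; lia.
case: z => i Hi; [left|right]; apply/mapP; exists i; rewrite // mem_iota; lia.
Qed.

Lemma uniq_box (N : nat) : uniq (box N).
Proof.
rewrite cat_uniq !map_inj_uniq ?iota_uniq ?andbT /=; try by move=> i j [].
by apply/hasPn => z /mapP[i _ ->]; apply/mapP => -[].
Qed.

Fixpoint vectors (N d : nat) : seq (seq int) :=
  if d is d'.+1 then [seq z :: v | z <- box N, v <- vectors N d'] else [:: [::]].

Definition norm2 (v : seq int) : nat := sumn [seq (`|z| ^ 2)%N | z <- v].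

Definition sphere (N d n : nat) : seq (seq int) :=
  [seq v <- vectors N d | norm2 v == n].

Lemma mem_vectors (N d : nat) (v : seq int) :
  (v \in vectors N d) = (size v == d) && all (fun z : int => `|z| <= N)%N v.
Proof.
elim: d v => [|d IH] v; first by case: v => [|z v]; rewrite mem_seq1.
apply/allpairsP/idP => [[[z t] [/= Hz Ht ->]]|].
  by move: Hz Ht; rewrite mem_box IH /= eqSS => -> /andP[-> ->].
case: v => [//|z v] /= /and3P[Hs Hz Hv]; exists (z, v); split => //=.
  by rewrite mem_box.
by rewrite IH -eqSS Hs.
Qed.

Lemma uniq_vectors (N d : nat) : uniq (vectors N d).
Proof.
elim: d => [//|d IH]; apply: allpairs_uniq => //; first exact: uniq_box.
by move=> [z v] [z' v'] _ _ /= [-> ->].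
Qed.

(** A coordinate z satisfies |z| <= z^2 <= n <= N, so the box excludes nothing and the size of
    [sphere N d n] is r_d(n). *)
Lemma mem_sphere (N d n : nat) (v : seq int) : (n <= N)%N ->
  (v \in sphere N d n) = (size v == d) && (norm2 v == n).
Proof.
move=> le_nN; rewrite mem_filter mem_vectors andbC -andbA; congr (_ && _).
case: eqP => [Hn|_]; last by rewrite andbF.
rewrite andbT; apply/allP => z zv; apply: leq_trans le_nN; rewrite -Hn.
elim: v zv {Hn} => [//|y v IH]; rewrite in_cons /norm2 /= => /orP[/eqP <-|/IH].
  by nia.
by rewrite /norm2; lia.
Qed.

Lemma theta_exp_sum {R : comNzRingType} (q : R) (N d : nat) :
  theta q N ^+ d = \sum_(v <- vectors N d) (- q) ^+ norm2 v.
Proof.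
elim: d => [|d IH]; first by rewrite big_seq1 expr0.
rewrite exprS IH big_distrlr [RHS]big_allpairs_dep.
by apply: eq_bigr => z _; apply: eq_bigr => v _; rewrite /= -exprD.
Qed.

Lemma exprNX {R : comNzRingType} (k : nat) : (- 'X) ^+ k = (- 1) ^+ k *: 'X^k :> {poly R}.
Proof. by rewrite -scaleN1r exprZn. Qed.

Lemma coef_theta_exp {R : comNzRingType} (N d n : nat) :
  (theta 'X N ^+ d : {poly R})`_n = (- 1) ^+ n * (size (sphere N d n))%:R.
Proof.
rewrite theta_exp_sum coef_sum size_filter -sum1_count natr_sum mulr_sumr.
rewrite [RHS]big_mkcond; apply: eq_bigr => v _.
rewrite exprNX coefZ coefXn eq_sym mulr1.
by case: eqP => [->|_]; rewrite ?mulr1 ?mulr0.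
Qed.

(** Squares are 0 or 1 modulo 4, so three of them sum to a multiple of 4 only if all are even. *)
Lemma even_of_sum3_sqr (a b c n : nat) :
  (a ^ 2 + (b ^ 2 + c ^ 2) = 4 * n)%N -> [/\ (2 %| a), (2 %| b) & (2 %| c)]%N.
Proof.
rewrite -!mulnn => H.
have [ra rb rc] : [/\ a %% 2 < 2, b %% 2 < 2 & c %% 2 < 2]%N by rewrite !ltn_mod.
move: H; rewrite (divn_eq a 2) (divn_eq b 2) (divn_eq c 2).
move: (a %/ 2)%N (b %/ 2)%N (c %/ 2)%N ra rb rc => x y z.
move: (a %% 2)%N (b %% 2)%N (c %% 2)%N => [|[|//]] [|[|//]] [|[|//]] _ _ _ H;
  split; rewrite ?addn0 ?dvdn_mull //; exfalso; nia.
Qed.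

Lemma size_sphere3_4 (N n : nat) : (4 * n <= N)%N ->
  size (sphere N 3 (4 * n)) = size (sphere N 3 n).
Proof.
move=> le_nN; rewrite -(size_map (map (fun z : int => 2 * z)) (sphere N 3 n)).
have inj2 : injective (map (fun z : int => 2 * z)).
  by apply: inj_map => x y /= H; lia.
apply/perm_size/uniq_perm; rewrite ?(map_inj_uniq inj2) ?filter_uniq ?uniq_vectors //.
move=> v; rewrite mem_sphere //; apply/andP/mapP => [[/eqP Hs /eqP Hn]|[w]]; last first.
  rewrite mem_sphere; last by lia.
  move=> /andP[Hs /eqP <-] ->; rewrite size_map; split=> //; apply/eqP.
  by rewrite /norm2; elim: w {Hs} => //= z w ->; rewrite abszM expnMn mulnDr.
case: v Hs Hn => [|a [|b [|c [|]]]] //= _; rewrite /norm2 /= addn0 => Hn.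
have [/(@dvdzP 2 a)[x Ea] /(@dvdzP 2 b)[y Eb] /(@dvdzP 2 c)[z Ec]] :=
  even_of_sum3_sqr _ _ _ _ Hn.
exists [:: x; y; z]; last by rewrite Ea Eb Ec /= !(mulrC 2).
rewrite mem_sphere; last by lia.
apply/eqP; move: Hn; rewrite /norm2 /= Ea Eb Ec !abszM !expnMn addn0; lia.
Qed.

(** * Quaternions of norm 5 *)

Definition qmul (p x : seq int) : seq int :=
  [:: p`_0 * x`_0 - p`_1 * x`_1 - p`_2 * x`_2 - p`_3 * x`_3;
      p`_0 * x`_1 + p`_1 * x`_0 + p`_2 * x`_3 - p`_3 * x`_2;
      p`_0 * x`_2 - p`_1 * x`_3 + p`_2 * x`_0 + p`_3 * x`_1;
      p`_0 * x`_3 + p`_1 * x`_2 - p`_2 * x`_1 + p`_3 * x`_0].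

Definition qconj (p : seq int) : seq int := [:: p`_0; - p`_1; - p`_2; - p`_3].

Lemma absz_sqr (z : int) : (`|z| ^ 2)%N%:Z = z ^+ 2.
Proof. by rewrite -abszX gez0_abs // Num.Theory.sqr_ge0. Qed.

Lemma norm2_seq4 (a b c d : int) :
  (norm2 [:: a; b; c; d])%:Z = a ^+ 2 + b ^+ 2 + c ^+ 2 + d ^+ 2.
Proof.
by rewrite /norm2 /= !PoszD !absz_sqr; ring.
Qed.

(** Euler's four-square identity. *)
Lemma norm2_qmul (p x : seq int) : size p = 4 -> size x = 4 ->
  norm2 (qmul p x) = (norm2 p * norm2 x)%N.
Proof.
move: p x => [|a [|b [|c [|d []]]]] // [|e [|f [|g [|h []]]]] // _ _.
apply/eqP; rewrite -eqz_nat PoszM !norm2_seq4 /=; apply/eqP; ring.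
Qed.

Lemma qmul_conjK (p x : seq int) : size p = 4 -> size x = 4 ->
  qmul (qconj p) (qmul p x) = [seq (norm2 p)%:Z * z | z <- x].
Proof.
move: p x => [|a [|b [|c [|d []]]]] // [|e [|f [|g [|h []]]]] // _ _.
by rewrite norm2_seq4 /qmul /qconj /=; congr [:: _; _; _; _]; ring.
Qed.

Lemma qmul_Kconj (p x : seq int) : size p = 4 -> size x = 4 ->
  qmul p (qmul (qconj p) x) = [seq (norm2 p)%:Z * z | z <- x].
Proof.
move: p x => [|a [|b [|c [|d []]]]] // [|e [|f [|g [|h []]]]] // _ _.
by rewrite norm2_seq4 /qmul /qconj /=; congr [:: _; _; _; _]; ring.
Qed.

Lemma qmulZ (k : int) (p x : seq int) : size x = 4 ->
  qmul p [seq k * z | z <- x] = [seq k * z | z <- qmul p x].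
Proof.
move: x => [|e [|f [|g [|h []]]]] // _.
by rewrite /qmul /=; congr [:: _; _; _; _]; ring.
Qed.

(* When [norm2 p = 5], this says that [x] is a left multiple of [p]. *)
Definition left_div (p x : seq int) : bool :=
  all (fun z => 5 %| z)%Z (qmul (qconj p) x).

(** Left multiplication by [p] is a bijection from the quaternions of norm [n] to the left multiples
    of [p] of norm [5 * n]. Its inverse is x -> conj(p) x / 5, where conj(p) x has norm 25 n. *)
Lemma count_left_div (N n : nat) (p : seq int) :
  (5 * n <= N)%N -> size p = 4 -> norm2 p = 5%N ->
  count (left_div p) (sphere N 4 (5 * n)) = size (sphere N 4 n).
Proof.
move=> le_nN sp np; rewrite -size_filter -(size_map (qmul p) (sphere N 4 n)).
have inj5 : injective (map (fun z : int => Posz 5 * z)) by apply: inj_map => x y /= H; lia.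
have le_nN' : (n <= N)%N by lia.
apply/perm_size/uniq_perm; rewrite ?filter_uniq ?uniq_vectors //.
  rewrite map_inj_in_uniq ?filter_uniq ?uniq_vectors // => x y.
  rewrite !mem_sphere // => /andP[/eqP sx _] /andP[/eqP sy _] E.
  by apply: inj5; rewrite -np -!qmul_conjK // E.
move=> x; rewrite mem_filter mem_sphere //; apply/andP/mapP => [[Hd]|[y]].
  move=> /andP[/eqP sx /eqP nx].
  exists [seq (z %/ 5)%Z | z <- qmul (qconj p) x].
    rewrite mem_sphere // size_map andTb; apply/eqP.
    have : norm2 (qmul (qconj p) x) = (5 * (5 * n))%N.
      rewrite norm2_qmul // nx; congr (_ * _)%N.
      by rewrite -np; move: p sp {np Hd} => [|a [|b [|c [|d []]]]] // _; rewrite /norm2 /= !abszN.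
    move: Hd; rewrite /left_div; move: (qmul _ _) => w.
    have key : all (fun z => 5 %| z)%Z w -> norm2 w = (25 * norm2 [seq (z %/ 5)%Z | z <- w])%N.
      elim: w => [//|z w IH] /= /andP[/dvdzP[k ->] /IH E].
      rewrite /norm2 /= -/(norm2 w) E mulzK // abszM expnMn /norm2; lia.
    by move=> /key ->; lia.
  apply: inj5; rewrite -np -qmul_Kconj // -qmulZ ?np //; congr (qmul p _).
  rewrite -map_comp map_id_in // => z /(allP Hd) /= /dvdzP[k ->].
  by rewrite mulzK // mulrC.
rewrite mem_sphere // => /andP[/eqP sy /eqP ny] ->; split.
  rewrite /left_div qmul_conjK // np; apply/allP => z /mapP[t _ ->].
  exact: dvdz_mulr.
by rewrite norm2_qmul // np ny !eqxx.
Qed.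

(** One representative for each class of the 48 integer quaternions of norm 5 under right
    multiplication by the 8 units. *)
Definition norm5_quaternions : seq (seq int) :=
  [:: [:: 1; 2; 0; 0]; [:: 1; - 2; 0; 0]; [:: 1; 0; 2; 0]; [:: 1; 0; - 2; 0];
      [:: 1; 0; 0; 2]; [:: 1; 0; 0; - 2]].

Lemma dvdz_congr (d k u v : int) : u = v + k * d -> (d %| u)%Z = (d %| v)%Z.
Proof. by move=> ->; rewrite rpredDr // dvdz_mull. Qed.

Lemma left_div_mod (p x : seq int) : size x = 4 ->
  left_div p x = left_div p [seq (z %% 5)%Z | z <- x].
Proof.
case: x => [|a [|b [|c [|d []]]]] // _; rewrite /left_div /qmul /qconj /=.
congr [&& _, _, _ & _]; last rewrite !andbT.
(* Each coordinate of conj(p) x is linear in x, so the multiple of 5 to discard is that same linear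
   form at the quotients by 5. *)
- apply: (dvdz_congr _ (p`_0 * (a %/ 5)%Z + p`_1 * (b %/ 5)%Z + p`_2 * (c %/ 5)%Z
     + p`_3 * (d %/ 5)%Z)).
  rewrite {1}(divz_eq a 5) {1}(divz_eq b 5) {1}(divz_eq c 5) {1}(divz_eq d 5); ring.
- apply: (dvdz_congr _ (p`_0 * (b %/ 5)%Z - p`_1 * (a %/ 5)%Z - p`_2 * (d %/ 5)%Z
     + p`_3 * (c %/ 5)%Z)).
  rewrite {1}(divz_eq a 5) {1}(divz_eq b 5) {1}(divz_eq c 5) {1}(divz_eq d 5); ring.
- apply: (dvdz_congr _ (p`_0 * (c %/ 5)%Z + p`_1 * (d %/ 5)%Z - p`_2 * (a %/ 5)%Z
     - p`_3 * (b %/ 5)%Z)).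
  rewrite {1}(divz_eq a 5) {1}(divz_eq b 5) {1}(divz_eq c 5) {1}(divz_eq d 5); ring.
apply: (dvdz_congr _ (p`_0 * (d %/ 5)%Z - p`_1 * (c %/ 5)%Z + p`_2 * (b %/ 5)%Z
     - p`_3 * (a %/ 5)%Z)).
rewrite {1}(divz_eq a 5) {1}(divz_eq b 5) {1}(divz_eq c 5) {1}(divz_eq d 5); ring.
Qed.

Lemma dvd_norm2_mod (x : seq int) :
  (5 %| norm2 x)%N = (5 %| norm2 [seq (z %% 5)%Z | z <- x])%N.
Proof.
suff: norm2 x = norm2 [seq (z %% 5)%Z | z <- x] %[mod 5] by rewrite /dvdn => ->.
elim: x => [//|z x IH]; rewrite /norm2 /= -!/(norm2 _) -modnDmr IH modnDmr.
apply/eqP; rewrite eqn_modDr.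
rewrite -eqz_nat -!modz_nat !absz_sqr.
by rewrite modzXm.
Qed.

(** Both conditions depend only on the coordinates modulo 5, so these 625 vectors cover every case;
    the counts 1 and 6 agree modulo 5. *)
Lemma residues_check :
  all (fun v => (5 %| norm2 v)%N ==>
                (count (fun p => left_div p v) norm5_quaternions %% 5 == 1)%N)
    [seq [:: Posz u.1; Posz u.2; Posz w.1; Posz w.2] |
      u <- [seq (a, b) | a <- iota 0 5, b <- iota 0 5],
      w <- [seq (c, d) | c <- iota 0 5, d <- iota 0 5]].
Proof. by vm_compute. Qed.

Lemma count_norm5_left_div (x : seq int) : size x = 4 -> (5 %| norm2 x)%N ->
  (count (fun p => left_div p x) norm5_quaternions = 1 %[mod 5])%N.
Proof.
move=> sx; rewrite dvd_norm2_mod.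
rewrite (eq_count (a2 := fun p => left_div p [seq (z %% 5)%Z | z <- x])); last first.
  by move=> p; rewrite left_div_mod.
have residue (z : int) : exists2 r : nat, (z %% 5)%Z = r & r \in iota 0 5.
  exists `|(z %% 5)%Z|%N; first by rewrite gez0_abs // modz_ge0.
  by rewrite mem_iota; lia.
case: x sx => [|a [|b [|c [|d []]]]] // _ /=.
case: (residue a) (residue b) (residue c) (residue d) => [i -> Hi] [j -> Hj] [k -> Hk] [l -> Hl].
move=> H; apply/eqP; move: H; apply/implyP.
apply: (allP residues_check [:: Posz i; Posz j; Posz k; Posz l]).
apply/allpairsP; exists ((i, j), (k, l)).
by split => //; apply/allpairsP; [exists (i, j)|exists (k, l)].
Qed.

Lemma size_sphere4_5 (N n : nat) : (5 * n <= N)%N ->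
  (size (sphere N 4 (5 * n)) = size (sphere N 4 n) %[mod 5])%N.
Proof.
move=> le_nN.
have counts : (\sum_(p <- norm5_quaternions) count (left_div p) (sphere N 4 (5 * n)) =
               6 * size (sphere N 4 n))%N.
  rewrite (eq_big_seq (fun=> size (sphere N 4 n))); last first.
    move=> p Hp; apply: count_left_div => //; apply/eqP.
      by move: p Hp; apply/allP.
    by move: p Hp; apply/allP.
  by rewrite !big_cons big_nil; lia.
have exchanged : (\sum_(p <- norm5_quaternions) count (left_div p) (sphere N 4 (5 * n)) =
    \sum_(x <- sphere N 4 (5 * n)) count (fun p => left_div p x) norm5_quaternions)%N.
  under eq_bigr do rewrite -sum1_count big_mkcond.
  rewrite exchange_big; apply: eq_bigr => x _.
  by rewrite -sum1_count [RHS]big_mkcond.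
have -> : (size (sphere N 4 n) = 6 * size (sphere N 4 n) %[mod 5])%N.
  by rewrite (mulnDl 5 1) mul1n mulnC modnMDl.
(* Summed over [x] first, every term is 1 modulo 5, which leaves the number of [x]. *)
rewrite -counts exchanged -modn_summ; congr (_ %% _)%N.
rewrite (eq_big_seq (fun=> 1%N)) ?sum1_size // => x.
rewrite mem_sphere // => /andP[/eqP sx /eqP nx].
by rewrite count_norm5_left_div // nx dvdn_mulr.
Qed.

(** * Reduction modulo 5 *)

Lemma coef0_theta {R : comNzRingType} (N : nat) : (theta 'X N : {poly R})`_0 = 1.
Proof.
elim: N => [|N IH]; first by rewrite theta0 coef1.
by rewrite thetaS coefD IH coefMn exprNX coefZ coefXn mulr0 mul0rn addr0.
Qed.

Lemma pbar_mul5 (n N : nat) : (n <= N)%N ->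
  (pbar (5 * n))%:R = (- 1) ^+ n * (size (sphere (5 * N) 3 n))%:R :> 'F_5.
Proof.
pose A : {poly 'F_5} := theta 'X (5 * N).
pose G : {poly 'F_5} := \poly_(i < (5 * N).+1) (pbar i)%:R.
pose G5 : {poly 'F_5} := \poly_(i < N.+1) (pbar (5 * i))%:R.
suff H : eq_trunc N.+1 G5 (A ^+ 3).
  by move=> le_nN; have := H n le_nN; rewrite coef_poly ltnS le_nN coef_theta_exp.
have char5 : 5 \in [pchar {poly 'F_5}] by rewrite pchar_poly pchar_Fp.
(* The Frobenius map gives theta(q)^5 = theta(q^5); the sign survives because 5 is odd. *)
have A5 : A ^+ 5 = \sum_(z <- box (5 * N)) (- 1) ^+ (`|z| ^ 2) *: 'X^(5 * `|z| ^ 2).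
  rewrite -(pFrobenius_autE char5) rmorph_sum; apply: eq_bigr => z _.
  rewrite /= pFrobenius_autE exprNX exprZn -!exprM [(_ * 5)%N]mulnC exprM.
  by congr (_ ^+ _ *: _); rewrite -signr_odd.
(* It remains to compare [A * G5] with [A ^+ 4], whose coefficients at [n] and [5 * n] agree by
   [size_sphere4_5]. *)
apply: (eq_trunc_mulI _ _ _ _ (coef0_theta (5 * N))) => {}n lt_nN.
rewrite -exprS coef_theta_exp.
have le_5n : (5 * n <= 5 * N)%N by lia.
have -> : (size (sphere (5 * N) 4 n))%:R = (size (sphere (5 * N) 4 (5 * n)))%:R :> 'F_5.
  by rewrite -(Fp_nat_mod (isT : prime 5)) -size_sphere4_5 // Fp_nat_mod.
have -> : (- 1) ^+ n = (- 1) ^+ (5 * n) :> 'F_5.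
  by rewrite exprM; congr (_ ^+ _); rewrite -signr_odd.
rewrite -coef_theta_exp -/A -[A ^+ 4]mul1r.
(* Since [G * A] is 1 up to degree [5 * N], [A ^+ 4] may be replaced by [G * A ^+ 5]. The exponents
   in [A ^+ 5] are multiples of 5, so its coefficient at [5 * n] involves only [pbar] at multiples
   of 5 and matches [A * G5] term by term. *)
rewrite -(eq_trunc_mul _ _ _ _ _ (pbar_theta _ (5 * N)) (fun _ _ => erefl)) //.
rewrite -/A -/G -mulrA -exprS A5 mulr_sumr /A /theta mulr_suml !coef_sum.
apply: eq_bigr => z _.
rewrite exprNX -scalerAr -scalerAl !coefZ coefMXn coefXnM !coef_poly.
by rewrite ltn_mul2l /= -mulnBr !ltnS leq_mul2l.
Qed.

Theorem theorem1p1 (n : nat) :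
  ((pbar (5 * n))%:Z = (-1) ^+ n * (pbar (20 * n))%:Z %[mod 5])%Z.
Proof.
apply/eqP; rewrite eqz_mod_dvd (dvdz_pcharf (pchar_Fp (isT : prime 5))).
rewrite rmorphB rmorphM rmorphXn rmorphN1 /= -!pmulrn.
rewrite (_ : (20 * n = 5 * (4 * n))%N); last by lia.
(* The same bound [4 * n] serves both sides, so that the two spheres lie in a common box. *)
rewrite (pbar_mul5 n (4 * n)) 1?(pbar_mul5 (4 * n) (4 * n)) //; last by lia.
rewrite size_sphere3_4; last by lia.
by rewrite -(signr_odd _ (4 * n)) oddM mul1r subrr.
Qed.
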